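(* Let $d\ge 1$ be an integer and let $\mathcal{G}$ be a graph on $n$ vertices whose maximum vertex degree is at most $d$. Then $\theta^{c}(\mathcal{G}) \le 16\, d^{5/2}\sqrt{n}$.
   Context: Graphs are finite, simple and undirected. For a graph $\mathcal{G}=(\mathcal{V},\mathcal{E})$ and positive integers $\alpha,\beta$, an $(\alpha\mid\beta)$-cointersection representation (CIR) of $\mathcal{G}$ consists of two disjoint finite sets of features $\mathcal{A},\mathcal{B}$ with $|\mathcal{A}|=\alpha$, $|\mathcal{B}|=\beta$, together with an assignment to each vertex $v$ of subsets $A_v\subseteq\mathcal{A}$, $B_v\subseteq\mathcal{B}$ (possibly empty), such that for all distinct $u,v\in\mathcal{V}$: $(u,v)\in\mathcal{E}$ if and only if $A_u\cap A_v\neq\varnothing$ and $B_u\cap B_v\neq\varnothing$. The cointersection number $\theta^{c}(\mathcal{G})$ is the minimum of $\alpha+\beta$ over all CIRs of $\mathcal{G}$. *)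

(* Defs.v *)
From mathcomp Require Import all_boot.

Set Implicit Arguments.
Unset Strict Implicit.
Unset Printing Implicit Defensive.

Record sgraph := SGraph {
  vertex :> finType;
  edge : rel vertex;
  edge_sym : symmetric edge;
  edge_irr : irreflexive edge
}.

Definition degree (G : sgraph) (v : G) : nat := #|[set u : G | edge v u]|.

Definition max_degree (G : sgraph) : nat := \max_(v : G) degree v.

(* The two feature sets are two finite types FA and FB, hence disjoint. *)
Definition is_CIR (G : sgraph) (FA FB : finType)
    (A : G -> {set FA}) (B : G -> {set FB}) : bool :=
  [forall u : G, forall v : G, (u != v) ==>
    (edge u v == (A u :&: A v != set0) && (B u :&: B v != set0))].

(* Feature names are immaterial, so a set of a features is taken to be 'I_a. *)
Definition has_CIR (G : sgraph) (a b : nat) : bool :=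
  [exists A : {ffun G -> {set 'I_a}}, exists B : {ffun G -> {set 'I_b}},
    is_CIR A B].

Definition has_CIR_total (G : sgraph) (m : nat) : bool :=
  [exists a : 'I_m.+1, exists b : 'I_m.+1,
    [&& 0 < a, 0 < b, a + b == m & has_CIR G a b]].

(* One feature of the first kind per ordered pair of vertices, given to both
   endpoints when the pair is an edge, and one common feature of the second. *)
Lemma has_CIR_total_ex (G : sgraph) : exists m, has_CIR_total G m.
Proof.
pose a := #|{: option (G * G)}|.
have a_gt0 : 0 < a by rewrite /a card_option.
exists (a + 1).
apply/existsP; exists (inord a); apply/existsP; exists (inord 1).
have -> : @inord (a + 1) a = a :> nat by rewrite inordK // ltnS leq_addr.
have -> : @inord (a + 1) 1 = 1 :> nat by rewrite inordK // ltnS leq_addl.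
rewrite a_gt0 eqxx /=.
pose F (v : G) (i : 'I_a) :=
  if enum_val i is Some p then edge p.1 p.2 && ((p.1 == v) || (p.2 == v))
  else false.
apply/existsP; exists [ffun v => [set i | F v i]].
apply/existsP; exists [ffun => [set: 'I_1]].
apply/forallP => u; apply/forallP => v; apply/implyP => uv.
rewrite !ffunE setIT.
have -> : [set: 'I_1] != set0 by apply/set0Pn; exists ord0; rewrite inE.
rewrite andbT; apply/eqP; apply/idP/set0Pn => [euv|[i]].
  exists (enum_rank (Some (u, v))).
  by rewrite !inE /F enum_rankK /= euv !eqxx orbT.
rewrite !inE /F; case: (enum_val i) => [[x y]|//] /=.
case/andP => /andP[exy xyu] /andP[_ xyv].
case/orP: xyu => /eqP xu; case/orP: xyv => /eqP xv; subst => //.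
- by rewrite eqxx in uv.
- by rewrite edge_sym.
- by rewrite eqxx in uv.
Qed.

Definition cointersection_number (G : sgraph) : nat :=
  ex_minn (has_CIR_total_ex G).

(* Main.v *)
Require Import Defs.
From mathcomp Require Import all_boot all_order all_algebra.
From mathcomp Require Import zify ring lra.

(** Give every edge its own feature pair (a, b), assigned to both its endpoints,
    treating the edges greedily one at a time.  Let r be about sqrt n, let each
    side have 4 d^2 r features, and let no feature be held by more than 2r
    vertices.  For a new edge xy, at most dr features a are too loaded, and at
    most 2(d-1) * 2r * d of them belong to some vertex already sharing a
    b-feature with x or y, which leaves at least 3dr choices for a, and likewise
    for b.  Of these 9 d^2 r^2 pairs, at most n d^2 lie inside some A_w x B_w,
    so some pair creates no unwanted cointersection. *)

Section Greedy.
Set Implicit Arguments.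
Unset Strict Implicit.
Unset Printing Implicit Defensive.

(** * Loads and the counting of admissible features *)

Lemma card_bigcup_leq_mul (I T : finType) (P : {set I}) (X : I -> {set T}) k :
  (forall i, i \in P -> #|X i| <= k) -> #|\bigcup_(i in P) X i| <= #|P| * k.
Proof.
move=> Xk; rewrite -sum_nat_const.
apply: (@leq_trans (\sum_(i in P) #|X i|)); last exact: leq_sum.
elim/big_rec2: _ => [|i m Y _ Ym]; first by rewrite cards0.
by rewrite (leq_trans (leq_card_setU _ _)) ?leq_add2l.
Qed.

Definition load (T F : finType) (A : T -> {set F}) (a : F) : nat :=
  #|[set w | a \in A w]|.

(** Double counting of the incidences [a \in A w]. *)
Lemma sum_load (T F : finType) (A : T -> {set F}) :
  \sum_a load A a = \sum_w #|A w|.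
Proof.
transitivity (\sum_a \sum_w (a \in A w : nat)).
  apply: eq_bigr => a _; rewrite /load -sum1_card big_mkcond /=.
  by apply: eq_bigr => w _; rewrite inE; case: (_ \in _).
rewrite exchange_big; apply: eq_bigr => w _ /=.
by rewrite -sum1_card [RHS]big_mkcond; apply: eq_bigr => a _; case: (_ \in _).
Qed.

(* The features [a] that may be added at the endpoints of a new edge [xy]
   without creating a vertex that shares an old [B]-feature and the new
   [A]-feature with [x] or [y]. *)
Definition admissible (T F : finType) (r : nat) (A B : T -> {set F}) (x y : T) :
    {set F} :=
  [set a | (load A a).+1 < 2 * r &
    [forall w, (a \in A w) ==> [disjoint B w & B x :|: B y]]].

(** A non-admissible feature is either nearly saturated ([full]) or held by a vertex sharing a
    [B]-feature with [x] or [y] ([bad]). The bound [d.-1] reflects that one of the at most [d] edges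
    at each endpoint, [xy] itself, has no feature yet. *)
Lemma card_admissible (T F : finType) (d r : nat) (A B : T -> {set F}) x y :
    0 < r -> 0 < d -> #|T| <= r ^ 2 -> #|F| = 4 * d ^ 2 * r ->
    (forall w, #|A w| <= d) -> (forall b, load B b <= 2 * r) ->
    #|B x| <= d.-1 -> #|B y| <= d.-1 ->
  3 * d * r <= #|admissible r A B x y|.
Proof.
move=> r0 d0 Tr cF Ad Br Bx By.
pose full := [set a | 2 * r <= (load A a).+1].
pose bad := \bigcup_(b in B x :|: B y) \bigcup_(w in [set w | b \in B w]) A w.
have full_le : #|full| <= d * r.
  (* Each feature in [full] accounts for at least [2 * r - 1] incidences, and each vertex for at
     most [d]. Then [r <= 2 * r - 1] and [#|T| <= r ^ 2] give the bound. *)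
  have fT : #|full| * (2 * r).-1 <= #|T| * d.
    rewrite -sum_nat_const -[leqRHS]sum_nat_const.
    apply: (@leq_trans (\sum_w #|A w|)); last exact: leq_sum.
    rewrite -sum_load [leqRHS](bigID (mem full)) /=.
    apply: leq_trans (leq_addr _ _).
    by apply: leq_sum => a; rewrite inE; lia.
  rewrite -(leq_pmul2r r0).
  apply: (@leq_trans (#|full| * (2 * r).-1)); first by rewrite leq_mul2l; lia.
  apply: leq_trans fT _.
  by rewrite -mulnA mulnC mulnn leq_mul2l Tr orbT.
have bad_le : #|bad| <= (2 * d.-1) * (2 * r * d).
  have Bxy : #|B x :|: B y| <= 2 * d.-1.
    by have := leq_of_leqif (leq_card_setU (B x) (B y)); lia.
  apply: (@leq_trans (#|B x :|: B y| * (2 * r * d))); last first.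
    by rewrite leq_mul2r Bxy orbT.
  apply: card_bigcup_leq_mul => b _.
  apply: (@leq_trans (load B b * d)); last by rewrite leq_mul2r Br orbT.
  exact: card_bigcup_leq_mul.
have sub : ~: admissible r A B x y \subset full :|: bad.
  apply/subsetP => a; rewrite !inE negb_and -leqNgt.
  case/orP => [->//|/forallPn[w]]; rewrite negb_imply => /andP[aw].
  case/pred0Pn => b /andP[bw bxy]; apply/orP; right.
  apply/bigcupP; exists b => //; apply/bigcupP; exists w => //.
  by rewrite inE.
have := subset_leq_card sub; have := leq_of_leqif (leq_card_setU full bad).
have := cardsC (admissible r A B x y); rewrite cF.
(* Writing [d] as a successor eliminates [d.-1]; the count is [4 * d ^ 2 * r - d * r - 4 * d * (d -
   1) * r = 3 * d * r]. *)
by case: d d0 {cF Ad Bx By} full_le bad_le => // d _ /=; nia.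
Qed.


(** * Giving a new feature to both endpoints of an edge *)

Definition give_feature (T F : finType) (A : T -> {set F}) (S : {set T}) a v :=
  if v \in S then a |: A v else A v.

(** Up to two vertices gain [a], so its load must start at [k - 2] or below; this is the origin of
    the successor in [admissible]. *)
Lemma load_give_feature (T F : finType) (A : T -> {set F}) x y a k :
    (load A a).+1 < k -> (forall c, load A c <= k) ->
  forall c, load (give_feature A [set x; y] a) c <= k.
Proof.
move=> Aa Ak c; have [->|ca] := eqVneq c a.
  have sub : [set w | a \in give_feature A [set x; y] a w] \subset
      [set w | a \in A w] :|: [set x; y].
    apply/subsetP => w; rewrite !inE /give_feature !inE.
    by case: ifP; rewrite ?orbT ?orbF.
  have := subset_leq_card sub.
  have := leq_of_leqif (leq_card_setU [set w | a \in A w] [set x; y]).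
  by rewrite cards2 /load in Aa *; case: (x != y) => /=; lia.
apply: leq_trans (Ak c); apply/subset_leq_card/subsetP => w.
by rewrite !inE /give_feature; case: ifP; rewrite // !inE (negbTE ca).
Qed.

Lemma card_give_feature (T F : finType) (A : T -> {set F}) S a v :
  #|give_feature A S a v| <= #|A v| + (v \in S).
Proof.
rewrite /give_feature; case: ifP => _; last by rewrite addn0.
by rewrite cardsU1; case: (_ \notin _) => /=; lia.
Qed.

Lemma setU1I_neq0 (F : finType) (a : F) (X Y : {set F}) :
  ((a |: X) :&: Y != set0) = (a \in Y) || (X :&: Y != set0).
Proof.
apply/set0Pn/orP => [[c]|[aY|/set0Pn[c]]].
- rewrite !inE => /andP[/orP[/eqP->|cX] cY]; first by left.
  by right; apply/set0Pn; exists c; rewrite inE cX.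
- by exists a; rewrite !inE eqxx.
- by rewrite inE => /andP[cX cY]; exists c; rewrite !inE cX cY orbT.
Qed.

(* Removing the pairs inside [[set x; y]] removes just the edge [xy], as [e] is
   irreflexive. *)
Lemma card_nbhs_del_edge (T : finType) (e : rel T) x y v :
    symmetric e -> irreflexive e -> e x y ->
  #|[set u | e v u]| =
  #|[set u | e v u && ~~ ((v \in [set x; y]) && (u \in [set x; y]))]| +
    (v \in [set x; y]).
Proof.
move=> es ei exy.
have del z w : e z w -> #|[set u | e z u]| =
    #|[set u | e z u && ~~ ((u == z) || (u == w))]| + 1.
  move=> ezw; rewrite (cardsD1 w) inE ezw addnC; congr (_ + _).
  apply: eq_card => u; rewrite !inE andbC.
  by case: (eqVneq u z) => [->|_]; rewrite ?ei.
case: (boolP (v \in _)) => [|_]; last first.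
  by rewrite addn0; apply: eq_card => u; rewrite !inE andbT.
rewrite !inE => /orP[]/eqP-> /=.
  by rewrite (del x y exy); congr (_ + _); apply: eq_card => u; rewrite !inE.
have eyx : e y x by rewrite es.
by rewrite (del y x eyx); congr (_ + _); apply: eq_card => u; rewrite !inE orbC.
Qed.

Definition cointersecting (T F : finType) (A B : T -> {set F}) u v :=
  (A u :&: A v != set0) && (B u :&: B v != set0).

(** Only pairs with exactly one endpoint [u] in [[set x; y]] need care. If the other vertex [v]
    holds [a], admissibility makes [B v] disjoint from [B u], and [v] does not hold [b], so the
    [B]-side stays empty; the case of [b] is symmetric. *)
Lemma cointersecting_give_feature (T F : finType) (e : rel T) (r : nat)
    (A B : T -> {set F}) (x y : T) (a b : F) :
    symmetric e -> e x y ->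
    (forall u v, u != v ->
      e u v && ~~ ((u \in [set x; y]) && (v \in [set x; y])) =
      cointersecting A B u v) ->
    a \in admissible r A B x y -> b \in admissible r B A x y ->
    (forall w, ~~ ((a \in A w) && (b \in B w))) ->
  forall u v, u != v ->
    e u v = cointersecting (give_feature A [set x; y] a)
                           (give_feature B [set x; y] b) u v.
Proof.
move=> es exy eAB; rewrite !inE => /andP[_ /forallP aA] /andP[_ /forallP bB] ab.
have cC (A' B' : T -> {set F}) u v :
    cointersecting A' B' u v = cointersecting A' B' v u.
  by rewrite /cointersecting setIC [B' u :&: _]setIC.
have disj (X : T -> {set F}) u v : u \in [set x; y] ->
    [disjoint X v & X x :|: X y] -> X u :&: X v == set0.
  rewrite !inE => uxy; rewrite -setI_eq0 setIUr setU_eq0 => /andP[? ?].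
  by case/orP: uxy => /eqP->; rewrite setIC.
have mixed u v : u \in [set x; y] -> v \notin [set x; y] -> u != v ->
    e u v = cointersecting (give_feature A [set x; y] a)
                           (give_feature B [set x; y] b) u v.
  move=> uS vS uv; have := eAB u v uv.
  rewrite /cointersecting /give_feature uS (negbTE vS) andbT => ->.
  rewrite !setU1I_neq0; have := ab v.
  have := aA v; have := bB v.
  case: (boolP (a \in A v)); case: (boolP (b \in B v)) => //=.
    by move=> _ _ _ /(disj B u v uS) ->; rewrite andbF.
  by move=> _ _ /(disj A u v uS) ->.
move=> u v uv; case: (boolP (u \in [set x; y])) => uS;
  case: (boolP (v \in [set x; y])) => vS.
- have -> : e u v.
    move: uS vS uv; rewrite !inE.
    by move=> /orP[] /eqP-> /orP[] /eqP->; rewrite ?eqxx // es.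
  rewrite /cointersecting /give_feature uS vS; apply/esym/andP.
  by split; apply/set0Pn; [exists a|exists b]; rewrite !inE eqxx.
- exact: mixed.
- by rewrite es cC mixed // eq_sym.
- have := eAB u v uv; rewrite /cointersecting /give_feature.
  by rewrite (negbTE uS) (negbTE vS) andbT.
Qed.

(** * The greedy construction, by induction on the edges *)

Lemma CIR_no_edge (T F : finType) (e : rel T) k :
    (forall p : T * T, ~~ e p.1 p.2) ->
  exists A B : T -> {set F},
    [/\ forall u v, u != v -> e u v = cointersecting A B u v,
        forall v, #|A v| <= #|[set u | e v u]|,
        forall v, #|B v| <= #|[set u | e v u]|,
        forall a, load A a <= k & forall b, load B b <= k].
Proof.
move=> e0; have l0 c : load (fun=> set0 : {set F}) c <= k.
  by rewrite /load eq_card0 // => w; rewrite !inE.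
exists (fun=> set0), (fun=> set0).
split=> [u v _|||c|c]; rewrite ?cards0 // ?(l0 c) //.
by rewrite /cointersecting set0I eqxx; exact/negbTE/(e0 (u, v)).
Qed.

(** The bounds by degrees and loads are the invariant that keeps enough features admissible for the
    next edge. *)
Lemma exists_greedy_CIR (T F : finType) (d r : nat) :
    0 < r -> 0 < d -> #|T| <= r ^ 2 -> #|F| = 4 * d ^ 2 * r ->
  forall e : rel T, symmetric e -> irreflexive e ->
    (forall v, #|[set u | e v u]| <= d) ->
  exists A B : T -> {set F},
    [/\ forall u v, u != v -> e u v = cointersecting A B u v,
        forall v, #|A v| <= #|[set u | e v u]|,
        forall v, #|B v| <= #|[set u | e v u]|,
        forall a, load A a <= 2 * r & forall b, load B b <= 2 * r].
Proof.
move=> r0 d0 Tr cF e.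
(* The induction is on an upper bound for the number of adjacent ordered pairs, since deleting an
   edge removes two of them. *)
move: {2}#|_| (leqnn #|[set p : T * T | e p.1 p.2]|) => m.
elim: m e => [|m IH] e em es ei ed;
  have [/existsP[[x y] /= exy]|/existsPn e0] :=
    boolP [exists p : T * T, e p.1 p.2].
- move: em; rewrite leqn0 => /eqP/cards0_eq/setP/(_ (x, y)).
  by rewrite !inE exy.
- exact: CIR_no_edge.
- pose S := [set x; y]; pose e' u v := e u v && ~~ ((u \in S) && (v \in S)).
  have deg v : #|[set u | e v u]| = #|[set u | e' v u]| + (v \in S).
    exact: card_nbhs_del_edge.
  have e'm : #|[set p : T * T | e' p.1 p.2]| <= m.
    move: em; rewrite (cardsD1 (x, y)) inE exy ltnS; apply: leq_trans.
    apply/subset_leq_card/subsetP => p; rewrite !inE.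
    case/andP => -> nS; rewrite andbT; apply: contraNneq nS => ->.
    by rewrite !inE !eqxx orbT.
  have e's : symmetric e'.
    by move=> u v; rewrite /e' es [(u \in _) && _]andbC.
  have e'i : irreflexive e' by move=> u; rewrite /e' ei.
  have e'd v : #|[set u | e' v u]| <= d.
    by rewrite (leq_trans _ (ed v)) // deg leq_addr.
  have [A [B [eAB cA cB lA lB]]] := IH e' e'm e's e'i e'd.
  (* An endpoint of the deleted edge has degree at most [d - 1] in [e']. *)
  have S_small (X : T -> {set F}) z :
      (forall v, #|X v| <= #|[set u | e' v u]|) -> z \in S -> #|X z| <= d.-1.
    by move=> cX zS; have := deg z; have := ed z; have := cX z; rewrite zS; lia.
  have small (X : T -> {set F}) z :
      (forall v, #|X v| <= #|[set u | e' v u]|) -> #|X z| <= d.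
    by move=> cX; exact: leq_trans (cX z) (e'd z).
  have xS : x \in S by rewrite !inE eqxx.
  have yS : y \in S by rewrite !inE eqxx orbT.
  have gA : 3 * d * r <= #|admissible r A B x y|.
    by apply: card_admissible => // *; by [apply: small | apply: S_small].
  have gB : 3 * d * r <= #|admissible r B A x y|.
    by apply: card_admissible => // *; by [apply: small | apply: S_small].
  (* There are at least [9 * d ^ 2 * r ^ 2] admissible pairs, while the products [A w] times [B w]
     cover at most [#|T| * d ^ 2 <= r ^ 2 * d ^ 2] pairs; positivity of [d] and [r] makes the
     comparison strict. *)
  have [[a b] /=]:
      exists2 p, p \in setX (admissible r A B x y) (admissible r B A x y)
               & p \notin \bigcup_(w in [set: T]) setX (A w) (B w).
    apply/subsetPn; apply/negP => /subset_leq_card; apply/negP; rewrite -ltnNge.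
    rewrite cardsX.
    have : #|\bigcup_(w in [set: T]) setX (A w) (B w)| <= #|[set: T]| * (d * d).
      by apply: card_bigcup_leq_mul => w _; rewrite cardsX leq_mul ?small.
    rewrite cardsT => /leq_ltn_trans; apply.
    apply: (@leq_trans ((3 * d * r) * (3 * d * r))); last exact: leq_mul.
    by nia.
  rewrite in_setX /= => /andP[aA bB] /bigcupP ab.
  exists (give_feature A S a), (give_feature B S b); split.
  + apply: (@cointersecting_give_feature T F e r) => // w.
    by apply/negP => /andP[aw bw]; apply: ab; exists w; rewrite ?inE ?aw.
  + by move=> v; rewrite deg (leq_trans (card_give_feature _ _ _ _)) ?leq_add2r.
  + by move=> v; rewrite deg (leq_trans (card_give_feature _ _ _ _)) ?leq_add2r.
  + by apply: load_give_feature => //; move: aA; rewrite inE => /andP[].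
  + by apply: load_give_feature => //; move: bB; rewrite inE => /andP[].
- exact: CIR_no_edge.
Qed.

(** * Choice of [r] and the final estimate *)

Lemma exists_sqrt_approx n :
  0 < n -> exists r, [/\ 0 < r, n <= r ^ 2 & r ^ 2 <= 4 * n].
Proof.
move=> n0; have ex : exists r, n <= r ^ 2 by exists n; nia.
case: (ex_minnP ex) => r nr r_min; exists r; split=> //.
  by case: r nr {r_min} => //; lia.
case: r nr r_min => [|[|r]] nr r_min; [by [] | by lia |].
(* Minimality gives [(r + 1) ^ 2 < n], and [r + 2 <= 2 * (r + 1)]. *)
have: ~~ (n <= r.+1 ^ 2) by apply/negP => /r_min; rewrite ltnn.
by rewrite -ltnNge; nia.
Qed.

(** Each side uses its own copy of ['I_s] with [s = 4 * d ^ 2 * r], for a total of [2 * s]. *)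
Lemma cointersection_number_le (G : sgraph) d r :
    0 < r -> 0 < d -> max_degree G <= d -> #|G| <= r ^ 2 ->
  cointersection_number G <= 8 * d ^ 2 * r.
Proof.
move=> r0 d0 Gd Gr; pose s := 4 * d ^ 2 * r.
have deg (v : G) : #|[set u | edge v u]| <= d.
  by apply: leq_trans Gd; exact: (leq_bigmax v).
have [A [B [eAB _ _ _ _]]] :=
  exists_greedy_CIR r0 d0 Gr (card_ord s) (@edge_sym G) (@edge_irr G) deg.
rewrite /cointersection_number; case: ex_minnP => m _; apply.
have s0 : 0 < s by rewrite /s; nia.
have -> : 8 * d ^ 2 * r = s + s by rewrite /s; lia.
apply/existsP; exists (inord s); apply/existsP; exists (inord s).
have -> : @inord (s + s) s = s :> nat by rewrite inordK // ltnS leq_addr.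
rewrite s0 eqxx /=.
apply/existsP; exists [ffun v => A v]; apply/existsP; exists [ffun v => B v].
apply/forallP => u; apply/forallP => v; apply/implyP => uv.
by rewrite !ffunE eAB.
Qed.

End Greedy.

From mathcomp Require Import all_classical all_reals all_analysis.
Import Order.TTheory GRing.Theory Num.Theory.
Local Open Scope ring_scope.

(** From [r ^ 2 <= 4 * n] comes [r <= 2 * sqrt n], which turns [8 * d ^ 2 * r] into
    [16 * d ^ 2 * sqrt n]; since [d >= 1], the exponent 2 may be raised to 5/2. *)
Theorem theorem5 (R : realType) (d n : nat) (G : sgraph)
    (hd : (1 <= d)%N) (hn : (1 <= n)%N) (hG : #|G| = n)
    (hdeg : (max_degree G <= d)%N) :
  (cointersection_number G)%:R <= 16 * (d%:R `^ (5 / 2)) * Num.sqrt n%:R :> R.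
Proof.
have [r [r0 nr rn]] := exists_sqrt_approx hn.
have := cointersection_number_le r0 hd hdeg.
rewrite hG => /(_ nr); rewrite -(ler_nat R) => /le_trans; apply.
have r_le : r%:R <= 2 * Num.sqrt n%:R :> R.
  rewrite -ler_sqr ?nnegrE ?mulr_ge0 ?sqrtr_ge0 //.
  rewrite exprMn sqr_sqrtr // -!natrX -natrM ler_nat; lia.
have d_le : (d ^ 2)%:R <= d%:R `^ (5 / 2) :> R.
  rewrite natrX -powR_mulrn //; apply: ler_powR; first by rewrite ler1n.
  by lra.
rewrite natrM natrM.
have -> : 16 * d%:R `^ (5 / 2) * Num.sqrt n%:R =
    8 * d%:R `^ (5 / 2) * (2 * Num.sqrt n%:R) :> R by ring.
by apply: ler_pM; rewrite ?mulr_ge0 ?ler0n // ler_pM2l.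
Qed.
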